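(* Let $n$ be a positive integer and let $P(x_1,\ldots,x_n)$ be a polynomial over a field $F$. Suppose that $k_1,\ldots,k_n$ are nonnegative integers with $k_1+\cdots+k_n=\deg P$ and $[x_1^{k_1}\cdots x_n^{k_n}]P(x_1,\ldots,x_n)\neq 0$. Let $A_1,\ldots,A_n$ be finite subsets of $F$ with $|A_i|>k_i$ for $i=1,\ldots,n$. Then, for the restricted sumset $$C=\{x_1+\cdots+x_n:\ x_1\in A_1,\ldots,x_n\in A_n,\ \text{and}\ P(x_1,\ldots,x_n)\neq 0\},$$ we have $$|C|\geqslant\min\{p(F)-\deg P,\ |A_1|+\cdots+|A_n|-n-2\deg P+1\}.$$
   Context: $\deg P$ is the total degree of $P$, and $[x_1^{k_1}\cdots x_n^{k_n}]P(x_1,\ldots,x_n)$ is the coefficient of the monomial $x_1^{k_1}\cdots x_n^{k_n}$ in $P$. $p(F)$ denotes the additive order of the multiplicative identity of $F$: it equals the characteristic of $F$ if this is a prime, and $p(F)=+\infty$ if $F$ has characteristic zero (in which case $\min\{p(F)-c,\,x\}=x$ for integers $c,x$). *)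

(* Defs.v *)
From HB Require Import structures.
From mathcomp Require Import all_boot all_order all_algebra.
From mathcomp Require Import finmap mpoly.
From mathcomp Require Import boolp constructive_ereal.

Set Implicit Arguments.
Unset Strict Implicit.
Unset Printing Implicit Defensive.

Import Order.TTheory GRing.Theory Num.Theory.
Local Open Scope ring_scope.

(* The additive order of 1, with value +oo when no positive multiple of 1
   vanishes. *)
Definition add_order_one (F : fieldType) : \bar int :=
  match pselect (exists m : nat, (0 < m)%N && (m%:R == 0 :> F)) with
  | left h => ((ex_minn h)%:Z)%:E
  | right _ => +oo%E
  end.

Lemma add_order_one_pchar (F : fieldType) (p : nat) :
  p \in [pchar F] -> add_order_one F = (p%:Z)%:E.
Proof.
move=> pF; have p_gt0 := prime_gt0 (pcharf_prime pF).
have p0 : (p%:R == 0 :> F) by rewrite -(dvdn_pcharf pF).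
rewrite /add_order_one; case: pselect => [h|[]]; last by exists p; rewrite p_gt0.
case: ex_minnP => m /andP[m_gt0 m0] m_min.
suff -> : m = p by [].
apply/eqP; rewrite eqn_leq m_min ?p_gt0 //=.
by apply: dvdn_leq => //; rewrite (dvdn_pcharf pF).
Qed.

Lemma add_order_one_pchar0 (F : fieldType) :
  [pchar F] =i pred0 -> add_order_one F = +oo%E.
Proof.
move=> /pcharf0P F0; rewrite /add_order_one; case: pselect => // h.
by exfalso; case: h => m; rewrite F0; case: m.
Qed.

(* [msize] is one more than the total degree, and [msize 0 = 0]. *)
Definition total_deg (n : nat) (R : nzRingType) (P : {mpoly R[n]}) : nat :=
  (msize P).-1.

(* [x] ranges over the finite product of the sets [A i]. *)
Definition restricted_sumset (n : nat) (F : fieldType) (P : {mpoly F[n]})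
    (A : 'I_n -> {fset F}) : {fset F} :=
  [fset \sum_(i < n) val ((x : {dffun forall i : 'I_n, A i}) i) | x in
     [set x : {dffun forall i : 'I_n, A i}
        | P.@[fun i => val (x i)] != 0]]%fset.

Lemma restricted_sumsetP (n : nat) (F : fieldType) (P : {mpoly F[n]})
    (A : 'I_n -> {fset F}) (c : F) :
  c \in restricted_sumset P A <->
  exists x : 'I_n -> F,
    [/\ forall i, x i \in A i, P.@[x] != 0 & c = \sum_(i < n) x i].
Proof.
split=> [/imfsetP[x /=] | [x [xA Px ->]]].
  rewrite inE => Px ->; exists (fun i => val (x i)); split=> // i.
  exact: valP.
apply/imfsetP.
pose y : {dffun forall i, A i} := [ffun i => FSetSub (xA i)].
have yE i : val (y i) = x i by rewrite ffunE.
exists y => /=; last by apply: eq_bigr => i _; rewrite yE.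
by rewrite inE (_ : (fun i => val (y i)) = x) //; apply/funext.
Qed.

(* Main.v *)
Require Import Defs.
From HB Require Import structures.
From mathcomp Require Import all_boot all_order all_algebra.
From mathcomp Require Import finmap mpoly.
From mathcomp Require Import boolp constructive_ereal.
From mathcomp Require Import zify.

Set Implicit Arguments.
Unset Strict Implicit.
Unset Printing Implicit Defensive.

Import Order.TTheory GRing.Theory Num.Theory.
Local Open Scope ring_scope.

(** The proof is by the polynomial method. Write d = deg P, let [x^b] Q be the
    coefficient of x^b in Q, and put S = x_1 + ... + x_n.

    Suppose that b_i < |A_i| for all i, that |b| = d + M and that
    [x^b](P S^M) != 0. If |C| <= M, then P times a product of M linear forms
    S - c, where c runs through all of C, vanishes on the product of the A_i;
    but it has the same coefficient at x^b as P S^M, which contradicts the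
    Combinatorial Nullstellensatz. Hence |C| > M
    ([card_restricted_sumset_gt]).

    It remains to find a good b. Up to factorials the coefficient is explicit
    ([coef_mul_sum_vars_exp]):
      b_1! ... b_n! [x^b](P S^M) = M! P*(b),
    where P* arises from the homogeneous part of degree d of P by replacing each
    power x_i^j by the falling factorial x_i (x_i - 1) ... (x_i - j + 1).
    The coefficient of P* at x^k is still nonzero, so the Nullstellensatz,
    applied a second time and now to P*, yields a point b with P*(b) != 0 in
    any box of integer points c_i <= b_i <= c_i + k_i, as long as
    p(F) is larger than every k_i. With c_i + k_i < |A_i| this b is
    admissible, and M = |b| - d >= c_1 + ... + c_n - d. To get |C| >= r it
    suffices to have c_1 + ... + c_n = r + d - 1, and such c_i exist when
    r + d - 1 is at most the sum of the |A_i| - 1 - k_i, which is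
    |A_1| + ... + |A_n| - n - d. Moreover M <= r + d - 1, because |b| exceeds
    c_1 + ... + c_n by at most d, so M! is nonzero in F when r + d <= p(F).
    These are the two terms of the minimum.
    The factors b_i! may vanish in F, but this is harmless: when M! P*(b) is
    nonzero, so are both factors on the left of the identity.

    Both uses of the Nullstellensatz are instances of [nullstellensatz_basis],
    in which the powers of the variables are replaced by any sequence of
    polynomials q_0, q_1, ... with deg q_j = j. *)

(** * A Nullstellensatz for products of univariate polynomials *)

(** On polynomials of degree at most k, the coefficient of X^k is a linear
    combination of the values at any k + 1 distinct points, by inversion of a
    Vandermonde matrix. *)
Lemma top_coef_weights (F : fieldType) (k : nat) (x : nat -> F) :
    {in [pred t | (t <= k)%N] &, injective x} ->
  exists w : nat -> F, forall f : {poly F}, (size f <= k.+1)%N ->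
    \sum_(t < k.+1) w t * f.[x t] = f`_k.
Proof.
move=> x_inj; pose a : 'rV[F]_k.+1 := \row_t x t.
pose V := Vandermonde k.+1 a.
have V_unit : V \in unitmx.
  rewrite unitmxE det_Vandermonde unitfE prodf_seq_neq0.
  apply/allP => i _; rewrite prodf_seq_neq0; apply/allP => j _.
  apply/implyP => lt_ij; rewrite !mxE subr_eq0; apply/eqP => /x_inj xji.
  by move: lt_ij; rewrite xji ?ltnn // inE -ltnS ltn_ord.
have [w Vw] : exists w : 'cV_k.+1, forall m, (V *m w) m ord0 = (m == ord_max)%:R.
  by exists (invmx V *m delta_mx ord_max ord0) => m; rewrite mulKVmx // mxE andbT.
exists (fun t => w (inord t) ord0) => f size_f.
under eq_bigr => t _ do rewrite inord_val (horner_coef_wide _ size_f) mulr_sumr.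
rewrite exchange_big /= (bigD1 ord_max) //= [X in _ + X]big1 => [|m neq_m].
  rewrite addr0; transitivity (f`_k * (V *m w) ord_max ord0); last first.
    by rewrite Vw eqxx mulr1.
  rewrite mxE mulr_sumr; apply: eq_bigr => t _.
  by rewrite !mxE mulrCA [w t _ * _]mulrC.
transitivity (f`_m * (V *m w) m ord0); last by rewrite Vw (negPf neq_m) mulr0.
by rewrite mxE mulr_sumr; apply: eq_bigr => t _; rewrite !mxE mulrCA [w t _ * _]mulrC.
Qed.

Lemma exists_small_exponent (n : nat) (m k : 'X_{1..n}) :
  (mdeg m <= mdeg k)%N -> m != k -> exists i, (m i < k i)%N.
Proof.
move=> le_mk neq_mk; apply/existsP; apply: contraNT neq_mk.
rewrite negb_exists => /forallP ge_mk; rewrite eq_sym.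
have := @leqif_sum _ predT (fun i => k i == m i) k m
  (fun i _ => leqif_eq (etrans (leqNgt _ _) (ge_mk i))).
rewrite -!mdegE => -[le_km eq_km].
have := eqn_leq (mdeg k) (mdeg m).
rewrite le_km le_mk eq_km => /forallP eq_all.
by apply/eqP/mnmP => i; apply/eqP/eq_all.
Qed.

(** Apply in each variable x_i the functional of [top_coef_weights] for
    degree k_i. The tensor product of these functionals is a linear combination
    of the evaluations at the points of the grid. It kills every term of index
    m != k, because such an m has some m_i < k_i, and it sends the term of
    index k to c_k times nonzero leading coefficients. So the values on the
    grid cannot all vanish. *)
Lemma nullstellensatz_basis (n : nat) (F : fieldType) (s : seq 'X_{1..n})
    (c : 'X_{1..n} -> F) (k : 'X_{1..n}) (q : nat -> {poly F})
    (x : 'I_n -> nat -> F) :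
    uniq s -> k \in s -> c k != 0 ->
    (forall m, m \in s -> (mdeg m <= mdeg k)%N) ->
    (forall j, size (q j) = j.+1) ->
    (forall i, {in [pred t | (t <= k i)%N] &, injective (x i)}) ->
  exists t : 'I_n -> nat, (forall i, t i <= k i)%N /\
    \sum_(m <- s) c m * \prod_(i < n) (q (m i)).[x i (t i)] != 0.
Proof.
move=> s_uniq ks ck deg_s size_q x_inj.
have /fin_all_exists [w wP] i := top_coef_weights (x_inj i).
(* A common index type for the grids of all variables. *)
pose K := (mdeg k).+1.
have k_lt i : (k i < K)%N by rewrite ltnS mdegE (bigD1 i) //= leq_addr.
have weightedE i (f : {poly F}) : (size f <= (k i).+1)%N ->
    \sum_(t < K | (t <= k i)%N) w i t * f.[x i t] = f`_(k i).
  by move=> size_f; rewrite (big_ord_narrow (k_lt i)) /= wP.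
pose T (t : 'I_n -> nat) :=
  \sum_(m <- s) c m * \prod_(i < n) (q (m i)).[x i (t i)].
pose Q i : pred 'I_K := fun t => (t <= k i)%N.
have sumE : \sum_(t in family Q) (\prod_(i < n) w i (t i)) * T (fun i => t i)
    = c k * \prod_(i < n) lead_coef (q (k i)).
  transitivity (\sum_(m <- s) c m *
      \prod_(i < n) \sum_(t < K | Q i t) w i t * (q (m i)).[x i t]).
    under eq_bigr => t _ do rewrite mulr_sumr.
    rewrite exchange_big /=; apply: eq_bigr => m _.
    rewrite bigA_distr_big_dep mulr_sumr; apply: eq_bigr => t _.
    by rewrite big_split /= mulrCA.
  rewrite (bigD1_seq k) //= [X in _ + X]big_seq_cond [X in _ + X]big1; last first.
    move=> m /andP[ms neq_mk].
    have [i lt_i] := exists_small_exponent (deg_s m ms) neq_mk.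
    rewrite (bigD1 i) //= weightedE ?size_q; last by rewrite ltnS ltnW.
    by rewrite nth_default ?size_q // mul0r mulr0.
  rewrite addr0; congr (_ * _); apply: eq_bigr => i _.
  by rewrite weightedE ?size_q // lead_coefE size_q.
have prod_neq0 : c k * \prod_(i < n) lead_coef (q (k i)) != 0.
  rewrite mulf_neq0 // prodf_seq_neq0; apply/allP => i _ /=.
  by rewrite lead_coef_eq0 -size_poly_eq0 size_q.
have [[t tQ Tt]|T0] := pselect (exists2 t : {ffun 'I_n -> 'I_K},
    t \in family Q & T (fun i => t i) != 0).
  by exists (fun i => t i : nat); split=> // i; exact: (familyP tQ i).
move: prod_neq0; rewrite -sumE big1 ?eqxx // => t tQ.
have [->|Tt] := eqVneq (T (fun i => t i)) 0; first by rewrite mulr0.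
by case: T0; exists t.
Qed.

Lemma combinatorial_nullstellensatz (n : nat) (F : fieldType)
    (P : {mpoly F[n]}) (k : 'X_{1..n}) (A : 'I_n -> {fset F}) :
    (msize P <= (mdeg k).+1)%N -> P@_k != 0 -> (forall i, k i < #|` A i|)%N ->
  exists x : 'I_n -> F, (forall i, x i \in A i) /\ P.@[x] != 0.
Proof.
move=> size_P Pk cardA.
have [|||||i|t [le_tk Pt]] := @nullstellensatz_basis n F (msupp P) (fun m => P@_m) k
  (fun j => 'X^j) (fun i => nth 0 (A i)).
- exact: msupp_uniq.
- by rewrite mcoeff_msupp.
- by [].
- by move=> m /msize_mdeg_lt /leq_trans /(_ size_P).
- by move=> j; rewrite size_polyXn.
- move=> t u; rewrite !inE => tk uk /eqP.
  by rewrite nth_uniq ?fset_uniq ?(leq_ltn_trans _ (cardA i)) // => /eqP.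
exists (fun i => nth 0 (A i) (t i)); split=> [i|].
  by apply: mem_nth; exact: leq_ltn_trans (cardA i).
rewrite mevalE; congr (_ != 0): Pt; apply: eq_bigr => m _; congr (_ * _).
by apply: eq_bigr => i _; rewrite hornerXn.
Qed.

(** * The coefficient criterion for restricted sumsets *)

(** Subtracting constants from the factors s does not affect the terms of the
    highest possible degree. *)
Lemma top_coef_prod_shifts (n : nat) (R : idomainType) (s : {mpoly R[n]})
    (cs : seq R) (Q : {mpoly R[n]}) (D : nat) :
    (msize s <= 2)%N -> (msize Q <= D.+1)%N ->
  (msize (Q * \prod_(c <- cs) (s - c%:MP)) <= (D + size cs).+1)%N /\
  forall m, mdeg m = (D + size cs)%N ->
    (Q * \prod_(c <- cs) (s - c%:MP))@_m = (Q * s ^+ size cs)@_m.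
Proof.
move=> size_s.
have size_mul p q a b : (msize p <= a.+1 -> msize q <= b.+1 ->
    msize (p * q : {mpoly R[n]}) <= (a + b).+1)%N.
  have [->|p0] := eqVneq p 0; first by rewrite mul0r msize0.
  have [->|q0] := eqVneq q 0; first by rewrite mulr0 msize0.
  by rewrite msizeM //; lia.
elim: cs Q D => [|c cs IH] Q D size_Q.
  by rewrite big_nil mulr1 addn0.
have size_lin : (msize (s - c%:MP) <= 2)%N.
  rewrite (leq_trans (mmeasureD_le _ _ _)) // geq_max size_s mmeasureN msizeC.
  by case: (c != 0).
have [IHsize IHcoef] := IH (Q * (s - c%:MP)) D.+1
  ltac:(by rewrite -addn1 size_mul).
rewrite big_cons mulrA addnS; split=> [|m deg_m]; first by rewrite -addSn.
rewrite IHcoef ?addSn // mulrBr mulrBl mcoeffB exprS !mulrA.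
rewrite [X in _ - X](_ : _ = 0) ?subr0 //.
have size_pow j : (msize (s ^+ j) <= j.+1)%N.
  elim: j => [|j IHj]; first by rewrite expr0 msize1.
  by rewrite exprS; apply: (size_mul _ _ 1%N j).
rewrite mulrAC mulrC mul_mpolyC mcoeffZ memN_msupp_eq0 ?mulr0 //.
by apply: msize_mdeg_ge; rewrite deg_m size_mul.
Qed.

(** If C had at most M elements, P times the product of the S - c over c in C
    would vanish at every point of the product of the A_i: either P vanishes
    there, or the sum of the coordinates lies in C. *)
Lemma card_restricted_sumset_gt (n : nat) (F : fieldType) (P : {mpoly F[n]})
    (A : 'I_n -> {fset F}) (b : 'X_{1..n}) (M : nat) :
    mdeg b = (total_deg P + M)%N -> (forall i, b i < #|` A i|)%N ->
    (P * (\sum_(i < n) 'X_i) ^+ M)@_b != 0 ->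
  (M < #|` restricted_sumset P A|)%N.
Proof.
move=> deg_b cardA coef_b; rewrite ltnNge; apply/negP => le_CM.
pose C := restricted_sumset P A.
(* C is padded with arbitrary constants to a list of length exactly M. *)
pose cs : seq F := C ++ nseq (M - #|` C|) 0.
have size_cs : size cs = M by rewrite size_cat size_nseq subnKC.
have size_sum : (msize (\sum_(i < n) 'X_i : {mpoly F[n]}) <= 2)%N.
  apply: leq_trans (mmeasure_sum _ _ _ _) _.
  by apply/bigmax_leqP => i _; rewrite mmeasureX ltnS; apply/eq_leq/mdeg1.
have size_P : (msize P <= (total_deg P).+1)%N by rewrite leqSpred.
have [size_Q coef_Q] := top_coef_prod_shifts cs size_sum size_P.
rewrite size_cs in size_Q coef_Q.
rewrite -(coef_Q b deg_b) in coef_b.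
have [|x [xA]] := combinatorial_nullstellensatz _ coef_b cardA.
  by rewrite deg_b.
rewrite mevalM mulf_eq0 negb_or => /andP[Px].
have xC : \sum_(i < n) x i \in cs.
  rewrite mem_cat; apply/orP; left; apply/restricted_sumsetP; by exists x.
rewrite rmorph_prod /= (big_rem _ xC) /= mevalB mevalC raddf_sum /=.
by under eq_bigr => i _ do rewrite mevalXU; rewrite subrr mul0r eqxx.
Qed.

(** * Coefficients of products with powers of the sum of the variables *)

(** With Q_b b_1! ... b_n! as normalized coefficients, multiplication by the sum
    of the variables becomes a recursion without denominators. The weight b_i
    also covers the indices with b_i = 0, for which b - U_i is truncated. *)
Lemma mcoeffM_sum_vars (n : nat) (R : comNzRingType) (Q : {mpoly R[n]})
    (b : 'X_{1..n}) :
  (\prod_(i < n) (b i)`!)%:R * (Q * \sum_(i < n) 'X_i)@_b =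
  \sum_(i < n) (b i)%:R *
    ((\prod_(l < n) ((b - U_(i))%MM l)`!)%:R * Q@_(b - U_(i))).
Proof.
rewrite mulr_sumr raddf_sum mulr_sumr; apply: eq_bigr => i _ /=.
have [b0|b_gt0] := posnP (b i).
  rewrite b0 mul0r mcoeffM [X in _ * X]big1 ?mulr0 // => -[m u] /= /eqP bE.
  rewrite mcoeffX; case: eqP => [uE|_]; last by rewrite mulr0.
  have biE : b i = ((bmnm m + bmnm u)%MM i) by rewrite -bE.
  by move: b0; rewrite biE -uE mnmDE mnm1E eqxx addn1.
have bE : b = ((b - U_(i)) + U_(i))%MM by rewrite submK // lep1mP -lt0n.
have -> : (Q * 'X_i)@_b = Q@_(b - U_(i)) by rewrite [in LHS]bE addmC mcoeffMX.
rewrite mulrA -natrM; congr (_%:R * _).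
rewrite (bigD1 i) //= [in RHS](bigD1 i) //= mulnA mnmBE mnm1E eqxx subn1.
rewrite -{1 2}(prednK b_gt0) factS; congr (_ * _)%N.
apply: eq_bigr => l neq_li.
by rewrite mnmBE mnm1E eq_sym (negPf neq_li) subn0.
Qed.

(** Each summand is (b_i - m_i) times the product on the right, since
    b (b - 1)^_m = b^_(m+1) = (b - m) b^_m, and the differences b_i - m_i add up
    to M. When m_i > b_i for some i, the subtraction is truncated but the
    product vanishes. *)
Lemma sum_ffact_pred (n M : nat) (m b : 'X_{1..n}) :
    mdeg b = (mdeg m + M)%N ->
  (\sum_(i < n) b i * \prod_(l < n) ((b - U_(i))%MM l) ^_ (m l)
   = M * \prod_(l < n) (b l) ^_ (m l))%N.
Proof.
move=> deg_b.
transitivity (\sum_(i < n) (b i - m i) * \prod_(l < n) (b l) ^_ (m l))%N.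
  apply: eq_bigr => i _.
  rewrite (bigD1 i) //= [in RHS](bigD1 i) //= !mulnA mnmBE mnm1E eqxx subn1.
  congr (_ * _)%N; last first.
    by apply: eq_bigr => l neq_li; rewrite mnmBE mnm1E eq_sym (negPf neq_li) subn0.
  by rewrite [RHS]mulnC -ffactnSr ffactnS.
have [/forallP le_mb|] := boolP [forall i, m i <= b i]%N; last first.
  rewrite negb_forall => /existsP[i lt_bm].
  have -> : (\prod_(l < n) (b l) ^_ (m l) = 0)%N.
    by rewrite (bigD1 i) //= ffact_small // ltnNge.
  by rewrite muln0 big1 // => l _; rewrite muln0.
rewrite -big_distrl /= sumnB //.
by rewrite -!mdegE deg_b addKn.
Qed.

(** By induction on M: both sides satisfy the same recursion, given by
    [mcoeffM_sum_vars] and [sum_ffact_pred]. For M = 0 only m = b contributes to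
    the right-hand side, as any other m of the same degree has some
    m_i > b_i. *)
Lemma coef_mul_sum_vars_exp (n : nat) (R : comNzRingType) (P : {mpoly R[n]})
    (d M : nat) (b : 'X_{1..n}) :
    mdeg b = (d + M)%N ->
  (\prod_(i < n) (b i)`!)%:R * (P * (\sum_(i < n) 'X_i) ^+ M)@_b =
  M`!%:R * \sum_(m <- msupp P | mdeg m == d)
               P@_m * (\prod_(i < n) (b i) ^_ (m i))%:R.
Proof.
elim: M b => [|M IH] b deg_b.
  rewrite addn0 in deg_b.
  have diag m : mdeg m == d -> m != b -> (\prod_(i < n) (b i) ^_ (m i) = 0)%N.
    move=> /eqP deg_m; rewrite eq_sym => neq_mb.
    have [|i lt_i] := exists_small_exponent (m := b) (k := m) _ neq_mb.
      by rewrite deg_b deg_m.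
    by rewrite (bigD1 i) //= ffact_small.
  rewrite expr0 mulr1 fact0 mul1r.
  have [bP|bP] := boolP (b \in msupp P); last first.
    rewrite memN_msupp_eq0 // mulr0 big_seq_cond big1 // => m /andP[mP deg_m].
    by rewrite diag ?mulr0 //; apply: contraNneq bP => <-.
  rewrite [RHS]big_mkcond [RHS](bigD1_seq b) ?msupp_uniq //= deg_b eqxx.
  rewrite [X in _ + X]big1 => [|m neq_mb].
    by rewrite addr0 mulrC; congr (_ * _%:R); apply: eq_bigr => i _; rewrite ffactnn.
  by case: ifP => // deg_m; rewrite diag ?mulr0.
rewrite exprSr mulrA mcoeffM_sum_vars.
have degB i : (0 < b i)%N -> mdeg (b - U_(i))%MM = (d + M)%N.
  move=> b_gt0; apply/eqP; rewrite -(eqn_add2r 1) -[X in (_ + X)%N == _](mdeg1 i).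
  by rewrite -mdegD submK ?deg_b ?addn1 ?addnS // lep1mP -lt0n.
transitivity (\sum_(i < n) (b i)%:R * (M`!%:R * \sum_(m <- msupp P | mdeg m == d)
    P@_m * (\prod_(l < n) ((b - U_(i))%MM l) ^_ (m l))%:R)).
  apply: eq_bigr => i _; have [->|b_gt0] := posnP (b i); first by rewrite !mul0r.
  by rewrite IH ?degB.
under eq_bigr => i _ do rewrite mulrCA mulr_sumr.
rewrite -mulr_sumr exchange_big /= factS mulnC natrM -mulrA; congr (_ * _).
rewrite mulr_sumr; apply: eq_bigr => m /eqP deg_m.
under eq_bigr => i _ do rewrite mulrCA -natrM.
by rewrite -mulr_sumr -natr_sum (sum_ffact_pred (M := M.+1)) ?deg_m // natrM mulrCA.
Qed.

(** * The lower bound *)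

Lemma exists_sum_eq (n : nat) (u : 'I_n -> nat) (t : nat) :
  (t <= \sum_(i < n) u i)%N ->
  exists v : 'I_n -> nat, (forall i, v i <= u i)%N /\ (\sum_(i < n) v i = t)%N.
Proof.
elim: t => [|t IH] le_t; first by exists (fun=> 0%N); split=> //; rewrite big1.
have [v [le_vu sum_v]] := IH (ltnW le_t).
have [/existsP[i lt_i]|] := boolP [exists i, v i < u i]%N.
  exists (fun j => v j + (j == i))%N; split=> [j|].
    by case: eqP => [->|_]; rewrite ?addn1 ?addn0.
  by rewrite big_split /= sum_v -big_mkcond /= big_pred1_eq addn1.
rewrite negb_exists => /forallP ge_vu; move: le_t.
rewrite ltnNge -sum_v => /negP[]; apply: leq_sum => i _.
by rewrite leqNgt ge_vu.
Qed.

Definition ffact_poly (R : nzRingType) (m : nat) : {poly R} :=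
  \prod_(l < m) ('X - (l%:R)%:P).

Lemma size_ffact_poly (R : nzRingType) m : size (ffact_poly R m) = m.+1.
Proof. by rewrite size_prod_XsubC /index_enum -enumT size_enum_ord. Qed.

Lemma horner_ffact_poly (R : comNzRingType) (m b : nat) :
  (ffact_poly R m).[b%:R] = (b ^_ m)%:R.
Proof.
rewrite /ffact_poly; elim: m => [|m IH]; first by rewrite big_ord0 hornerC ffactn0.
rewrite big_ord_recr hornerM IH hornerXsubC ffactnSr natrM /=.
have [le_mb|lt_bm] := leqP m b; first by rewrite natrB.
by rewrite ffact_small // !mul0r.
Qed.

Lemma fact_neq0 (F : fieldType) (M : nat) :
  (forall j, (0 < j <= M)%N -> j%:R != 0 :> F) -> M`!%:R != 0 :> F.
Proof.
elim: M => [|M IH] unitM; first by rewrite fact0 oner_eq0.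
rewrite factS natrM mulf_neq0 //; first by rewrite unitM ?leqnn.
by apply: IH => j /andP[j0 jM]; rewrite unitM // j0 leqW.
Qed.

(** The two terms of the minimum enter separately here: r is any number below
    both of them, and the condition r + deg P <= p(F) is expressed by the
    invertibility of the positive integers below r + deg P. *)
Lemma card_restricted_sumset_ge (n : nat) (F : fieldType) (P : {mpoly F[n]})
    (k : 'X_{1..n}) (A : 'I_n -> {fset F}) (r : nat) :
    mdeg k = total_deg P -> P@_k != 0 -> (forall i, k i < #|` A i|)%N ->
    (forall j, (0 < j < r + total_deg P)%N -> j%:R != 0 :> F) ->
    (r + n + 2 * total_deg P <= \sum_(i < n) #|` A i| + 1)%N ->
  (r <= #|` restricted_sumset P A|)%N.
Proof.
case: r => [//|r]; set d := total_deg P.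
move=> deg_k coef_k cardA char_gt sumA.
have sumkA : (\sum_(i < n) (#|` A i| - (k i).+1) + (d + n) = \sum_(i < n) #|` A i|)%N.
  rewrite -deg_k mdegE -[in X in (_ + (_ + X))%N](card_ord n) -sum1_card -!big_split /=.
  by apply: eq_bigr => i _; rewrite addn1 subnK.
(* The lower corner of the box; its coordinates add up to one less than the sum
   of d and the bound r.+1 that is being proved. *)
have [|c [le_c sum_c]] := @exists_sum_eq n (fun i => #|` A i| - (k i).+1)%N (r + d).
  by move: sumA sumkA; lia.
pose s := [seq m <- msupp P | mdeg m == d].
have k_le i : (k i <= d)%N by rewrite -deg_k mdegE (bigD1 i) //= leq_addr.
have [|||||i|t [le_tk]] := @nullstellensatz_basis n F s (fun m => P@_m) k
  (ffact_poly F) (fun i t => (c i + t)%:R).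
- by rewrite filter_uniq ?msupp_uniq.
- by rewrite mem_filter mcoeff_msupp coef_k deg_k eqxx.
- by [].
- by move=> m; rewrite mem_filter deg_k => /andP[/eqP->].
- exact: size_ffact_poly.
- have wlog_inj t u : (t < u <= k i)%N -> (c i + t)%:R != (c i + u)%:R :> F.
    case/andP=> lt_tu le_uk; rewrite eq_sym -subr_eq0 -natrB ?leq_add2l 1?ltnW //.
    by apply: char_gt; move: (k_le i) lt_tu le_uk; lia.
  move=> t u; rewrite !inE => tk uk /eqP.
  case: (ltngtP t u) => // lt_tu; first by rewrite (negPf (wlog_inj _ _ _)) ?lt_tu.
  by rewrite eq_sym (negPf (wlog_inj _ _ _)) ?lt_tu.
pose b := [multinom (c i + t i)%N | i < n].
have deg_bE : (mdeg b = r + d + \sum_(i < n) t i)%N.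
  by rewrite mdegE -sum_c -big_split /=; apply: eq_bigr => i _; rewrite mnmE.
have sum_t : (\sum_(i < n) t i <= d)%N by rewrite -deg_k mdegE leq_sum.
set M := (r + \sum_(i < n) t i)%N.
have deg_b : mdeg b = (d + M)%N by rewrite deg_bE /M; lia.
rewrite big_filter => sum_neq0.
suff : (M < #|` restricted_sumset P A|)%N by apply: leq_ltn_trans; exact: leq_addr.
apply: (card_restricted_sumset_gt deg_b) => [i|].
  by move: (le_c i) (cardA i) (le_tk i); rewrite mnmE; lia.
have : M`!%:R * \sum_(m <- msupp P | mdeg m == d)
    P@_m * (\prod_(i < n) (b i) ^_ (m i))%:R != 0.
  rewrite mulf_neq0 //.
    apply: fact_neq0 => j /andP[j0 jM]; apply: char_gt.
    by move: jM sum_t; rewrite j0 /M; lia.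
  congr (_ != 0): sum_neq0; apply: eq_bigr => m _; congr (_ * _).
  by rewrite natr_prod; apply: eq_bigr => i _; rewrite -horner_ffact_poly mnmE.
rewrite -(coef_mul_sum_vars_exp P deg_b).
by apply: contraNneq => ->; rewrite mulr0.
Qed.

Theorem theorem1p3 (n : nat) (n_gt0 : (0 < n)%N) (F : fieldType)
    (P : {mpoly F[n]}) (k : 'X_{1..n})
    (sum_k : (\sum_(i < n) k i)%N = total_deg P) (coef_k : P@_k != 0)
    (A : 'I_n -> {fset F}) (card_A : forall i : 'I_n, (k i < #|` A i|)%N) :
  (Order.min
     (add_order_one F - ((total_deg P)%:Z)%:E)
     ((\sum_(i < n) (#|` A i|)%:Z - n%:Z - 2 * (total_deg P)%:Z + 1)%R%:E)
   <= ((#|` restricted_sumset P A|)%:Z)%:E)%E.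
Proof.
rewrite -mdegE in sum_k.
have bound (r : nat) : (forall j, (0 < j < r + total_deg P)%N -> j%:R != 0 :> F) ->
    (r%:Z <= \sum_(i < n) (#|` A i|)%:Z - n%:Z - 2 * (total_deg P)%:Z + 1)%R ->
    (r <= #|` restricted_sumset P A|)%N.
  move=> char_gt; rewrite -(big_morph Posz PoszD (erefl _)) => le_r.
  apply: card_restricted_sumset_ge sum_k coef_k card_A char_gt _.
  by set N := (\sum_(i < n) _)%N in le_r *; lia.
move: bound; set X := (_ - _ + 1)%R => bound.
rewrite /add_order_one; case: pselect => [h|char0].
  case: ex_minnP => p _ p_min.
  rewrite -EFinB -EFin_min lee_fin.
  set m := Order.min _ _; case: (lerP m 0) => [/le_trans->//|m_gt0].
  have mE : m = `|m|%N%:Z by rewrite gtz0_abs.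
  have : (m <= X)%R by rewrite ge_min lexx orbT.
  have : (m <= p%:Z - (total_deg P)%:Z)%R by rewrite ge_min lexx.
  rewrite mE => le_p le_X; rewrite lez_nat; apply: bound le_X => j /andP[j_gt0 j_lt].
  apply: contraTneq j_lt => j0; rewrite -leqNgt.
  by have := p_min j; rewrite j_gt0 j0 eqxx => /(_ isT); lia.
rewrite ge_min; apply/orP; right; rewrite lee_fin.
case: (lerP X 0) => [/le_trans->//|X_gt0].
have XE : X = `|X|%N%:Z by rewrite gtz0_abs.
rewrite {1}XE lez_nat; apply: bound => [j /andP[j_gt0 _]|]; last by rewrite -XE.
by apply/negP => j0; apply: char0; exists j; rewrite j_gt0.
Qed.
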